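(* Let $B$ be a Banach $A$-bimodule and let $(e_\alpha)_\alpha\subseteq A$ be a bounded net which is an approximate identity both for $A$ (i.e. $e_\alpha a\to a$ and $ae_\alpha\to a$ for all $a\in A$) and for $B$ (i.e. $e_\alpha b\to b$ and $be_\alpha\to b$ for all $b\in B$), with $e_\alpha\to e''$ weak$^*$ in $A^{**}$. If $Z^t_{e''}(B^{**})=B^{**}$, $B^*A=B^*$ and $AB^*\neq B^*$, then $Z_{B^{**}}(A^{**})\neq Z^t_{B^{**}}(A^{**})$. Similarly, if $Z_{e''}(B^{**})=B^{**}$, $AB^*=B^*$ and $B^*A\neq B^*$, then $Z_{B^{**}}(A^{**})\neq Z^t_{B^{**}}(A^{**})$.
   Context: $A$ is a Banach algebra and $B$ a Banach $A$-bimodule with left action $\pi_\ell(a,b)=ab$ and right action $\pi_r(b,a)=ba$. For a bounded bilinear $m:X\times Y\to Z$ define $m^*:Z^*\times X\to Y^*$, $\langle m^*(z',x),y\rangle=\langle z',m(x,y)\rangle$; $m^{**}:Y^{**}\times Z^*\to X^*$, $\langle m^{**}(y'',z'),x\rangle=\langle y'',m^*(z',x)\rangle$; $m^{***}:X^{**}\times Y^{**}\to Z^{**}$, $\langle m^{***}(x'',y''),z'\rangle=\langle x'',m^{**}(y'',z')\rangle$. Let $m^t(y,x)=m(x,y)$ and $m^{t***t}(x'',y'')=(m^t)^{***}(y'',x'')$. Elements are identified with their canonical images in biduals. For $b'\in B^*$, $a\in A$ define $b'a,ab'\in B^*$ by $\langle b'a,b\rangle=\langle b',ab\rangle$ and $\langle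 ab',b\rangle=\langle b',ba\rangle$; $B^*A=\{b'a\}$, $AB^*=\{ab'\}$. Topological centers: $Z_{B^{**}}(A^{**})=\{a''\in A^{**}: b''\mapsto\pi_\ell^{***}(a'',b'')$ is weak$^*$-to-weak$^*$ continuous$\}$; $Z^t_{B^{**}}(A^{**})=\{a''\in A^{**}: b''\mapsto(\pi_r^t)^{***}(a'',b'')$ is weak$^*$-to-weak$^*$ continuous$\}$, where $\pi_r^t(a,b)=ba$. For $a''\in A^{**}$: $Z^t_{a''}(B^{**})=\{b''\in B^{**}:\pi_\ell^{t***t}(a'',b'')=\pi_\ell^{***}(a'',b'')\}$ and $Z_{a''}(B^{**})=\{b''\in B^{**}:\pi_r^{t***t}(b'',a'')=\pi_r^{***}(b'',a'')\}$. *)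

(* Defs.v *)
From mathcomp Require Import all_boot all_order all_algebra.
From mathcomp Require Import complex.
From mathcomp Require Import all_classical all_reals all_analysis.
Import numFieldNormedType.Exports.
Import Order.TTheory GRing.Theory Num.Theory.
Set Implicit Arguments.
Unset Strict Implicit.
Unset Printing Implicit Defensive.
Local Open Scope ring_scope.

Section BanachDefs.
Variable K : numFieldType.

Definition directed (I : Type) (le : I -> I -> Prop) : Prop :=
  [/\ (forall i, le i i),
      (forall i j k, le i j -> le j k -> le i k),
      (exists i : I, True)
    & (forall i j, exists k, le i k /\ le j k)].

Definition net_cvg (X : normedModType K) (I : Type) (le : I -> I -> Prop)
  (x : I -> X) (l : X) : Prop :=
  forall eps : K, 0 < eps -> exists i0, forall i, le i0 i -> `|x i - l| < eps.

Definition snet_cvg (I : Type) (le : I -> I -> Prop) (x : I -> K) (l : K) : Prop :=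
  forall eps : K, 0 < eps -> exists i0, forall i, le i0 i -> `|x i - l| < eps.

Definition bounded_net (X : normedModType K) (I : Type) (x : I -> X) : Prop :=
  exists C : K, forall i, `|x i| <= C.

Definition in_dual (X : normedModType K) (f : X -> K) : Prop :=
  (forall (k : K) (x y : X), f (k *: x + y) = k * f x + f y) /\
  (exists C : K, forall x, `|f x| <= C * `|x|).

(* An element of X^** is a bounded linear functional on X^* (with the
   operator norm on X^*: ||f|| = inf of the M >= 0 with |f x| <= M ||x||).
   Elements of X^** are represented by functions (X -> K) -> K, only their
   values on elements of X^* being meaningful. *)
Definition in_bidual (X : normedModType K) (F : (X -> K) -> K) : Prop :=
  (forall (k : K) (f g : X -> K), in_dual f -> in_dual g ->
      F (fun x => k * f x + g x) = k * F f + F g) /\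
  (exists C : K, forall (f : X -> K) (M : K), in_dual f -> 0 <= M ->
      (forall x, `|f x| <= M * `|x|) -> `|F f| <= C * M).

Definition bid_eq (X : normedModType K) (F G : (X -> K) -> K) : Prop :=
  forall f, in_dual f -> F f = G f.

Definition canon_emb (X : normedModType K) (x : X) : (X -> K) -> K := fun f => f x.

Definition wstar_cvg (X : normedModType K) (I : Type) (le : I -> I -> Prop)
  (u : I -> (X -> K) -> K) (l : (X -> K) -> K) : Prop :=
  forall f, in_dual f -> snet_cvg le (fun i => u i f) (l f).

(* weak*-to-weak* continuity of a map T : X^** -> Y^** (net characterization
   of continuity for the weak* topologies) *)
Definition wstar_continuous (X Y : normedModType K)
  (T : ((X -> K) -> K) -> ((Y -> K) -> K)) : Prop :=
  forall (I : Type) (le : I -> I -> Prop) (u : I -> (X -> K) -> K) (l : (X -> K) -> K),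
    directed le -> (forall i, in_bidual (u i)) -> in_bidual l ->
    wstar_cvg le u l -> wstar_cvg le (fun i => T (u i)) (T l).

Definition adj1 (X Y Z : Type) (m : X -> Y -> Z) : (Z -> K) -> X -> (Y -> K) :=
  fun z' x y => z' (m x y).
Definition adj2 (X Y Z : Type) (m : X -> Y -> Z) :
  ((Y -> K) -> K) -> (Z -> K) -> (X -> K) :=
  fun y'' z' x => y'' (adj1 m z' x).
Definition adj3 (X Y Z : Type) (m : X -> Y -> Z) :
  ((X -> K) -> K) -> ((Y -> K) -> K) -> ((Z -> K) -> K) :=
  fun x'' y'' z' => x'' (adj2 m y'' z').
Definition transp (X Y Z : Type) (m : X -> Y -> Z) : Y -> X -> Z :=
  fun y x => m x y.
Definition adj3t (X Y Z : Type) (m : X -> Y -> Z) :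
  ((X -> K) -> K) -> ((Y -> K) -> K) -> ((Z -> K) -> K) :=
  fun x'' y'' => adj3 (transp m) y'' x''.

Definition bilin (X Y Z : lmodType K) (m : X -> Y -> Z) : Prop :=
  (forall (k : K) x x' y, m (k *: x + x') y = k *: m x y + m x' y) /\
  (forall (k : K) x y y', m x (k *: y + y') = k *: m x y + m x y').

Definition banach_algebra (A : completeNormedModType K) (mul : A -> A -> A) : Prop :=
  [/\ bilin mul,
      (forall a b c, mul (mul a b) c = mul a (mul b c))
    & (forall a b, `|mul a b| <= `|a| * `|b|)].

Definition banach_bimodule (A : completeNormedModType K) (mul : A -> A -> A)
  (B : completeNormedModType K) (lact : A -> B -> B) (ract : B -> A -> B) : Prop :=
  [/\ bilin lact, bilin ract,
      (forall a a' b, lact (mul a a') b = lact a (lact a' b)),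
      (forall a a' b, ract b (mul a a') = ract (ract b a) a')
    & (forall a a' b, ract (lact a b) a' = lact a (ract b a'))] /\
  ((forall a b, `|lact a b| <= `|a| * `|b|) /\
   (forall a b, `|ract b a| <= `|b| * `|a|)).

Definition dual_ract (A B : Type) (lact : A -> B -> B) (b' : B -> K) (a : A) : B -> K :=
  fun b => b' (lact a b).
Definition dual_lact (A B : Type) (ract : B -> A -> B) (a : A) (b' : B -> K) : B -> K :=
  fun b => b' (ract b a).

Definition dualA_full (A B : normedModType K) (lact : A -> B -> B) : Prop :=
  forall b' : B -> K, in_dual b' ->
    exists (c' : B -> K) (a : A), in_dual c' /\ forall b, b' b = dual_ract lact c' a b.
Definition Adual_full (A B : normedModType K) (ract : B -> A -> B) : Prop :=
  forall b' : B -> K, in_dual b' ->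
    exists (c' : B -> K) (a : A), in_dual c' /\ forall b, b' b = dual_lact ract a c' b.

Definition topcenter (A B : normedModType K) (lact : A -> B -> B)
  (a'' : (A -> K) -> K) : Prop :=
  in_bidual a'' /\ wstar_continuous (fun b'' : (B -> K) -> K => adj3 lact a'' b'').
Definition topcenter_t (A B : normedModType K) (ract : B -> A -> B)
  (a'' : (A -> K) -> K) : Prop :=
  in_bidual a'' /\ wstar_continuous (fun b'' : (B -> K) -> K => adj3 (transp ract) a'' b'').

Definition Zt_at (A B : normedModType K) (lact : A -> B -> B)
  (a'' : (A -> K) -> K) (b'' : (B -> K) -> K) : Prop :=
  in_bidual b'' /\ bid_eq (adj3t lact a'' b'') (adj3 lact a'' b'').
Definition Z_at (A B : normedModType K) (ract : B -> A -> B)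
  (a'' : (A -> K) -> K) (b'' : (B -> K) -> K) : Prop :=
  in_bidual b'' /\ bid_eq (adj3t ract b'' a'') (adj3 ract b'' a'').

End BanachDefs.

(* Main.v *)
(** Primes denote duals.  If [e''] satisfies [Z^t_{e''}(B'') = B''] then [e'' b'' = b''] for
    all [b''], so [e''] lies in [Z_{B''}(A'')].  If it also lay in [Z^t_{B''}(A'')], weak*
    density of [B] in [B''] would give [<b'', b'> = lim <b'', e_i b'>] for all [b''] and [b'].
    By Hahn-Banach every [b'] is then in the norm closure of [A b'], hence [e_i b' -> b'] in
    norm, and Cohen's factorization theorem yields [A B' = B'].  The second half is the first
    one for the opposite algebra. *)
From HB Require Import structures.
Require Import Defs.
From mathcomp Require Import all_boot all_order all_algebra.
From mathcomp Require Import complex.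
From mathcomp Require Import all_classical all_reals all_analysis.
From mathcomp Require Import ring lra.
Import numFieldNormedType.Exports.
Import Order.TTheory GRing.Theory Num.Theory.
Local Open Scope ring_scope.

(** * Hahn-Banach theorem *)

(** As [a |-> a b'] is linear, the norm closure of [A b'] is a subspace, so a separating functional
    [F] kills every [a b']; the limit formula for [e''] then gives [F b' = e''(a |-> F (a b')) = 0].
    Closeness of [b'] to one [a b'] is upgraded to [e_i b' -> b'] by boundedness of the net and
    [e_i a -> a]. The delicate part is Cohen's theorem: [A] is not assumed unital and dual elements
    are bare functions. The factors [1 - g + g e_i] therefore act on [B], where completeness
    provides inverses, and dual elements are composed with these inverses. The two sides of the
    approximate identity do different work: [s e_i -> s] makes the partial products converge in [A],
    while [e_i c -> c] carries the condition [e_i y -> y] over to the next dual element. *)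

Section HahnBanach.
Local Open Scope classical_set_scope.
Local Open Scope complex_scope.
Variables (R : realType) (V : lmodType R[i]).
Implicit Types (p q : V -> R) (x y : V).

(** Scalars are reals embedded in [R[i]], so a complex space serves as its own real restriction.
    Homogeneity is only an inequality, which passes easily to infima; applying it to [r^-1] gives
    equality. *)
Definition sublinear p : Prop :=
  (forall x y, p (x + y) <= p x + p y) /\
  (forall r x, 0 < r -> p (r%:C *: x) <= r * p x).

Lemma sublinear0 p : sublinear p -> p 0 = 0.
Proof.
move=> [pD pZ]; have := pD 0 0; rewrite addr0 => h1.
have := pZ 2^-1 0; rewrite scaler0 invr_gt0 ltr0n => /(_ isT) h2.
lra.
Qed.

Lemma sublinearZ p r x : sublinear p -> 0 <= r -> p (r%:C *: x) = r * p x.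
Proof.
move=> sp; rewrite le_eqVlt => /orP[/eqP <-|r0].
  by rewrite rmorph0 scale0r mul0r sublinear0.
apply/eqP; rewrite eq_le sp.2//=.
have := sp.2 r^-1 (r%:C *: x); rewrite invr_gt0 r0 => /(_ isT).
rewrite scalerA -rmorphM mulVf ?gt_eqF// scale1r mulrC.
by rewrite ler_pdivlMr// mulrC.
Qed.

Lemma sublinearN p x : sublinear p -> - p (- x) <= p x.
Proof.
move=> sp; have := sp.1 x (- x); rewrite subrr sublinear0//; lra.
Qed.

(** Shared by three infima: over a ray, over a Zorn chain, and over distances to a subspace of the
    dual. *)
Lemma sublinear_inf (S : V -> set R) :
  (forall x, S x !=set0) -> (forall x, has_lbound (S x)) ->
  (forall x y s t, S x s -> S y t -> exists2 u, S (x + y) u & u <= s + t) ->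
  (forall r x s, 0 < r -> S x s -> exists2 u, S (r%:C *: x) u & u <= r * s) ->
  sublinear (fun x => inf (S x)).
Proof.
move=> S0 Slb SD SZ; split=> [x y|r x r0].
  rewrite -lerBlDl; apply: lb_le_inf => // t yt.
  rewrite lerBlDl -lerBlDr; apply: lb_le_inf => // s xs.
  rewrite lerBlDr; have [u Su us] := SD _ _ _ _ xs yt.
  by apply: le_trans us; apply: ge_inf.
rewrite -ler_pdivrMl//; apply: lb_le_inf => // s xs.
rewrite ler_pdivrMl//; have [u Su us] := SZ _ _ _ r0 xs.
by apply: le_trans us; apply: ge_inf.
Qed.

(* The largest sublinear minorant of [p] that is linear along the ray spanned by [x0]. *)
Definition ray_minorant p x0 x : R :=
  inf [set p (x + t%:C *: x0) - t * p x0 | t in [set t | 0 <= t]].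

Lemma ray_minorant_lb p x0 x : sublinear p ->
  lbound [set p (x + t%:C *: x0) - t * p x0 | t in [set t | 0 <= t]] (- p (- x)).
Proof.
move=> sp _ [t /= t0 <-]; have := sp.1 (x + t%:C *: x0) (- x).
rewrite addrAC subrr add0r sublinearZ//; lra.
Qed.

Lemma ray_minorant_le p x0 x t : sublinear p -> 0 <= t ->
  ray_minorant p x0 x <= p (x + t%:C *: x0) - t * p x0.
Proof.
move=> sp t0; apply: ge_inf; last by exists t.
by exists (- p (- x)); exact: ray_minorant_lb.
Qed.

Lemma ray_minorant_sublinear p x0 : sublinear p -> sublinear (ray_minorant p x0).
Proof.
move=> sp; apply: sublinear_inf.
- by move=> x; exists (p (x + 0%:C *: x0) - 0 * p x0); exists 0 => /=.
- by move=> x; exists (- p (- x)); exact: ray_minorant_lb.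
- move=> x y _ _ [s /= s0 <-] [t /= t0 <-].
  exists (p (x + y + (s + t)%:C *: x0) - (s + t) * p x0).
    by exists (s + t) => //=; rewrite addr_ge0.
  have := sp.1 (x + s%:C *: x0) (y + t%:C *: x0).
  rewrite addrACA -scalerDl -rmorphD; lra.
- move=> r x _ r0 [s /= s0 <-].
  exists (p (r%:C *: x + (r * s)%:C *: x0) - (r * s) * p x0).
    by exists (r * s) => //=; rewrite mulr_ge0// ltW.
  have := sp.2 r (x + s%:C *: x0) r0.
  rewrite scalerDr scalerA -rmorphM; lra.
Qed.

(** Take [t = 1], which cancels the argument of [p]. A sublinear [h] below the minorant then has
    [h x0 >= - h (- x0) >= p x0]. *)
Lemma ray_minorant_opp p x0 : sublinear p -> ray_minorant p x0 (- x0) <= - p x0.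
Proof.
move=> sp; apply: le_trans (ray_minorant_le p x0 (- x0) 1 sp _) _ => //.
rewrite rmorph1 scale1r addNr sublinear0//; lra.
Qed.

(** Zorn's lemma, chains being bounded below pointwise by [- p (- x)]. Minimality will force
    linearity, in place of the usual one-dimensional extension step. *)
Lemma exists_minimal_sublinear p : sublinear p ->
  exists g, [/\ sublinear g, (forall x, g x <= p x) &
    forall h, sublinear h -> (forall x, h x <= g x) -> forall x, g x <= h x].
Proof.
move=> sp.
pose T := {g : V -> R | sublinear g /\ forall x, g x <= p x}.
(* The order is reversed, so that a maximal element is a minimal functional. *)
pose le_T (g h : T) := `[< forall x, sval h x <= sval g x >].
have pT : sublinear p /\ forall x, p x <= p x by split.
have [||C Ctot|[g [sg gp]] gmax] := @ZL_preorder T (exist _ p pT) le_T.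
- by move=> t; apply/asboolP.
- move=> r s t /asboolP rs /asboolP st; apply/asboolP => x.
  exact: le_trans (rs x).
- have [C0|/set0P[c Cc]] := eqVneq C set0.
    by exists (exist _ p pT) => s; rewrite C0.
  pose S x := [set sval g x | g in C].
  have Slb x : lbound (S x) (- p (- x)).
    move=> _ [h _ <-]; apply: le_trans (sublinearN _ _ (svalP h).1).
    by rewrite lerN2 (svalP h).2.
  have Sle (h : T) x : C h -> inf (S x) <= sval h x.
    by move=> Ch; apply: ge_inf; [exists (- p (- x)); exact: Slb | exists h].
  have sS : sublinear (fun x => inf (S x)).
    apply: sublinear_inf.
    + by move=> x; exists (sval c x), c.
    + by move=> x; exists (- p (- x)); exact: Slb.
    + move=> x y _ _ [h Ch <-] [k Ck <-].
      have [/asboolP hk|/asboolP kh] := Ctot _ _ Ch Ck.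
        exists (sval k (x + y)); first by exists k.
        by apply: le_trans ((svalP k).1.1 _ _) _; rewrite lerD.
      exists (sval h (x + y)); first by exists h.
      by apply: le_trans ((svalP h).1.1 _ _) _; rewrite lerD.
    + move=> r x _ r0 [h Ch <-]; exists (sval h (r%:C *: x)); first by exists h.
      exact: (svalP h).1.2.
  have Sp x : inf (S x) <= p x by apply: le_trans (Sle _ _ Cc) ((svalP c).2 _).
  have ST : sublinear (fun x => inf (S x)) /\ forall x, inf (S x) <= p x by [].
  exists (exist _ (fun x => inf (S x)) ST) => h Ch; apply/asboolP => x /=.
  exact: Sle.
exists g; split=> // h sh hg x.
have hT : sublinear h /\ forall x, h x <= p x.
  by split=> // z; apply: le_trans (gp z).
have /asboolP := gmax (exist _ h hT) (asboolT hg).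
exact.
Qed.

Theorem Hahn_Banach_real p x0 : sublinear p ->
  exists g : V -> R, [/\ forall x y, g (x + y) = g x + g y,
    forall r x, g (r%:C *: x) = r * g x, forall x, g x <= p x & g x0 = p x0].
Proof.
move=> sp; have sp' := ray_minorant_sublinear p x0 sp.
have [g [sg gp' gmin]] := exists_minimal_sublinear _ sp'.
have p'p x : ray_minorant p x0 x <= p x.
  by have := ray_minorant_le p x0 x 0 sp (lexx _); rewrite rmorph0 scale0r addr0 mul0r subr0.
(* Minimality against [ray_minorant g x] gives [g (- x) <= - g x]; oddness then turns subadditivity
   into additivity. *)
have gN x : g (- x) = - g x.
  apply/eqP; rewrite eq_le; apply/andP; split; last first.
    have := sublinearN _ (- x) sg; rewrite opprK; exact.
  apply: le_trans _ (ray_minorant_opp g x sg).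
  apply: gmin => [|z]; first exact: ray_minorant_sublinear.
  by have := ray_minorant_le g x z 0 sg (lexx _); rewrite rmorph0 scale0r addr0 mul0r subr0.
have gp x : g x <= p x by exact: le_trans (gp' x) (p'p x).
exists g; split=> // [x y|r x|].
- apply/eqP; rewrite eq_le sg.1/=.
  have := sg.1 (- x) (- y); rewrite -opprD !gN; lra.
- have [r0|r0] := leP 0 r; first exact: sublinearZ.
  rewrite -[r]opprK rmorphN scaleNr gN sublinearZ ?mulNr//.
  by rewrite oppr_ge0 ltW.
(* Here it matters that [g] lies below [ray_minorant p x0] and not merely below [p]. *)
- apply/eqP; rewrite eq_le gp/=.
  have := le_trans (gp' (- x0)) (ray_minorant_opp p x0 sp).
  by rewrite gN lerN2.
Qed.

Theorem Hahn_Banach_complex p x0 : sublinear p ->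
  exists G : V -> R[i], [/\ forall k x y, G (k *: x + y) = k * G x + G y,
    forall x, complex.Re (G x) <= p x,
    forall x, complex.Im (G x) <= p (- ('i *: x)) & complex.Re (G x0) = p x0].
Proof.
move=> sp; have [g [gD gZ gp gx0]] := Hahn_Banach_real p x0 sp.
have gN x : g (- x) = - g x.
  by have := gZ (-1) x; rewrite rmorphN rmorph1 scaleN1r mulN1r.
(* The standard complexification [g x - i g (i x)]. As [p] need not be invariant under rotations,
   real and imaginary parts are bounded separately instead of the modulus. *)
exists (fun x => g x +i* (- g ('i *: x))); split=> //=.
- move=> [a b] x y.
  have kE : a +i* b = a%:C + b%:C * 'i :> R[i] by simpc.
  have ikE : 'i * (a +i* b) = a%:C * 'i + (- b)%:C :> R[i] by simpc.
  rewrite scalerDr scalerA ikE {1}kE !scalerDl -!scalerA !(gD, gZ); simpc.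
  by congr (_ +i* _); ring.
- by move=> x; rewrite -gN.
Qed.

End HahnBanach.

(** * Real-valued norms, nets and completeness *)

Section RealNorm.
Local Open Scope complex_scope.
Variable R : realType.

(** Norms take values in [R[i]]; the real part carries the same information in a totally ordered
    field. *)
Definition nrm (V : normedZmodType R[i]) (x : V) : R := complex.Re `|x|.
Arguments nrm {V} x.

Lemma nrmE (V : normedZmodType R[i]) (x : V) : `|x| = (nrm x)%:C.
Proof. by rewrite /nrm RRe_real// normr_real. Qed.

Lemma nrm_ge0 (V : normedZmodType R[i]) (x : V) : 0 <= nrm x.
Proof. by rewrite -ler0c -nrmE. Qed.

Lemma nrm0 (V : normedZmodType R[i]) : nrm (0 : V) = 0.
Proof. by rewrite /nrm normr0. Qed.

Lemma nrm0_eq0 (V : normedZmodType R[i]) (x : V) : nrm x = 0 -> x = 0.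
Proof. by move=> x0; apply/eqP; rewrite -normr_eq0 nrmE x0. Qed.

Lemma nrm_le_eps_eq0 (V : normedZmodType R[i]) (x : V) :
  (forall eps, 0 < eps -> nrm x <= eps) -> x = 0.
Proof.
move=> h; apply: nrm0_eq0; apply/eqP; rewrite eq_le nrm_ge0 andbT.
by apply/ler_addgt0Pr => eps /h; rewrite add0r.
Qed.

Lemma nrmN (V : normedZmodType R[i]) (x : V) : nrm (- x) = nrm x.
Proof. by rewrite /nrm normrN. Qed.

Lemma nrmB (V : normedZmodType R[i]) (x y : V) : nrm (x - y) = nrm (y - x).
Proof. by rewrite /nrm distrC. Qed.

Lemma nrmD (V : normedZmodType R[i]) (x y : V) : nrm (x + y) <= nrm x + nrm y.
Proof. by rewrite -lecR rmorphD /= -!nrmE ler_normD. Qed.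

Lemma nrmZ (X : normedModType R[i]) k (x : X) : nrm (k *: x) = nrm k * nrm x.
Proof. by apply: complexI; rewrite rmorphM /= -!nrmE normrZ. Qed.

Lemma nrmM (k l : R[i]) : nrm (k * l) = nrm k * nrm l.
Proof. by apply: complexI; rewrite rmorphM /= -!nrmE normrM. Qed.

Lemma nrm_real (r : R) : 0 <= r -> nrm r%:C = r.
Proof. by move=> r0; rewrite /nrm ger0_norm// ler0c. Qed.

Lemma nrm_Re (z : R[i]) : `|complex.Re z| <= nrm z.
Proof. by rewrite -lecR -nrmE normc_ge_Re. Qed.

Lemma nrm_i : nrm ('i : R[i]) = 1.
Proof. by rewrite /nrm normc_def/= expr0n/= add0r expr1n sqrtr1. Qed.

Lemma nrm_Im (z : R[i]) : `|complex.Im z| <= nrm z.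
Proof.
by have := nrm_Re (z * 'i); rewrite ReiNIm normrN nrmM nrm_i mulr1.
Qed.

Lemma nrm_ReIm (z : R[i]) : nrm z <= `|complex.Re z| + `|complex.Im z|.
Proof.
rewrite /nrm normc_def/= -[leRHS]ger0_norm ?addr_ge0// -sqrtr_sqr ler_sqrt ?sqr_ge0//.
by rewrite sqrrD !real_normK ?num_real// lerD2r lerDl mulrn_wge0// mulr_ge0.
Qed.

(** The constants in the basic definitions are complex, with no sign condition; the modulus is a
    nonnegative real substitute. *)
Lemma le_complex_bound (x : R) (C : R[i]) (z : R) :
  0 <= x -> 0 <= z -> x%:C <= C * z%:C -> x <= nrm C * z.
Proof.
move=> x0 z0 h; rewrite -lecR rmorphM /= -nrmE -[z%:C]ger0_norm ?ler0c// -normrM.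
by rewrite ger0_norm// (le_trans _ h)// ler0c.
Qed.

(** Dual norm at most [M], without a supremum; on differences it expresses distance in the dual. *)
Definition opbound (X : normedModType R[i]) (M : R) (f : X -> R[i]) : Prop :=
  forall x, nrm (f x) <= M * nrm x.
Arguments opbound {X} M f.

Definition is_lin (X : normedModType R[i]) (f : X -> R[i]) : Prop :=
  forall k x y, f (k *: x + y) = k * f x + f y.
Arguments is_lin {X} f.

Lemma in_dualP (X : normedModType R[i]) (f : X -> R[i]) :
  in_dual f <-> is_lin f /\ exists2 M : R, 0 <= M & opbound M f.
Proof.
split=> [[fl [C fC]]|[fl [M M0 fM]]]; split=> //.
  exists (nrm C); first exact: nrm_ge0.
  move=> x; apply: le_complex_bound; rewrite ?nrm_ge0//.
  by rewrite -!nrmE fC.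
exists M%:C => x; rewrite !nrmE -rmorphM lecR; exact: fM.
Qed.

Section Lin.
Variables (X : normedModType R[i]) (f : X -> R[i]).
Hypothesis fl : is_lin f.

Lemma is_linD x y : f (x + y) = f x + f y.
Proof. by rewrite -[x]scale1r fl !scale1r mul1r. Qed.

Lemma is_lin0 : f 0 = 0.
Proof. by have /(congr1 (fun z => z - f 0)) := is_linD 0 0; rewrite addr0 addrK subrr. Qed.

Lemma is_linZ k x : f (k *: x) = k * f x.
Proof. by rewrite -[k *: x]addr0 fl is_lin0 addr0. Qed.

Lemma is_linN x : f (- x) = - f x.
Proof. by rewrite -scaleN1r is_linZ mulN1r. Qed.

Lemma is_linB x y : f (x - y) = f x - f y.
Proof. by rewrite is_linD is_linN. Qed.

End Lin.

Lemma net_cvgP (X : normedModType R[i]) (I : Type) (le : I -> I -> Prop) (x : I -> X) l :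
  net_cvg le x l <-> forall eps : R, 0 < eps ->
    exists i0, forall i, le i0 i -> nrm (x i - l) < eps.
Proof.
split=> h eps eps0.
  have [|i0 hi] := h eps%:C; first by rewrite ltcR.
  by exists i0 => i /hi; rewrite nrmE ltcR.
have [z zE] : exists z, eps = z%:C by apply/complex_realP/ger0_real/ltW.
have [|i0 hi] := h z; first by rewrite -ltcR -zE.
by exists i0 => i /hi; rewrite nrmE zE ltcR.
Qed.

Lemma snet_cvgP (I : Type) (le : I -> I -> Prop) (x : I -> R[i]) l :
  snet_cvg le x l <-> forall eps : R, 0 < eps ->
    exists i0, forall i, le i0 i -> nrm (x i - l) < eps.
Proof.
split=> h eps eps0.
  have [|i0 hi] := h eps%:C; first by rewrite ltcR.
  by exists i0 => i /hi; rewrite nrmE ltcR.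
have [z zE] : exists z, eps = z%:C by apply/complex_realP/ger0_real/ltW.
have [|i0 hi] := h z; first by rewrite -ltcR -zE.
by exists i0 => i /hi; rewrite nrmE zE ltcR.
Qed.

Lemma in_dual_cvg (X : normedModType R[i]) (I : Type) (le : I -> I -> Prop)
    (x : I -> X) l f :
  in_dual f -> net_cvg le x l -> snet_cvg le (fun i => f (x i)) (f l).
Proof.
move=> /in_dualP[fl [M M0 fM]] /net_cvgP xl; apply/snet_cvgP => eps eps0.
have [|i0 hi] := xl (eps / (M + 1)); first by rewrite divr_gt0//; lra.
exists i0 => i /hi; rewrite -is_linB// ltr_pdivlMr; last by lra.
move=> h; apply: le_lt_trans (fM _) (le_lt_trans _ h).
by have := nrm_ge0 _ (x i - l); nra.
Qed.

Lemma snet_cvg_unique (I : Type) (le : I -> I -> Prop) (x : I -> R[i]) l l' :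
  directed le -> snet_cvg le x l -> snet_cvg le x l' -> l = l'.
Proof.
move=> [_ _ _ dir] /snet_cvgP xl /snet_cvgP xl'.
apply/eqP; rewrite -subr_eq0; apply/eqP/nrm_le_eps_eq0 => eps eps0.
have e2 : 0 < eps / 2 by lra.
have [i1 h1] := xl _ e2; have [i2 h2] := xl' _ e2.
have [i [/h1 {}h1 /h2 {}h2]] := dir i1 i2.
have := nrmD _ (l - x i) (x i - l'); rewrite addrA subrK (nrmB _ l (x i)); lra.
Qed.

Lemma snet_cvg_bound (I : Type) (le : I -> I -> Prop) (x : I -> R[i]) l (M : R) :
  directed le -> snet_cvg le x l -> (forall i, nrm (x i) <= M) -> nrm l <= M.
Proof.
move=> [refl _ _ _] /snet_cvgP xl xM.
rewrite leNgt; apply/negP => Ml; have [|i0 hi] := xl (nrm l - M); first by lra.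
have := hi _ (refl _); have := nrmD _ (l - x i0) (x i0).
rewrite subrK (nrmB _ l); have := xM i0; lra.
Qed.

Lemma snet_cvg_linear (I : Type) (le : I -> I -> Prop) (x y : I -> R[i]) k l l' :
  directed le -> snet_cvg le x l -> snet_cvg le y l' ->
  snet_cvg le (fun i => k * x i + y i) (k * l + l').
Proof.
move=> [_ tr _ dir] /snet_cvgP xl /snet_cvgP yl; apply/snet_cvgP => eps eps0.
have k0 := nrm_ge0 _ k.
have [|i1 h1] := xl (eps / 2 / (nrm k + 1)); first by rewrite divr_gt0//; lra.
have [|i2 h2] := yl (eps / 2); first by lra.
have [i0 [le1 le2]] := dir i1 i2; exists i0 => i le_i.
have := h2 _ (tr _ _ _ le2 le_i); have := h1 _ (tr _ _ _ le1 le_i).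
rewrite ltr_pdivlMr; last by lra.
have -> : k * x i + y i - (k * l + l') = k * (x i - l) + (y i - l') by ring.
have := nrmD _ (k * (x i - l)) (y i - l'); rewrite nrmM.
have := nrm_ge0 _ (x i - l); nra.
Qed.

Lemma snet_cvg_dist (I : Type) (le : I -> I -> Prop) (x : I -> R[i]) l (u : I -> R) :
  (forall i, nrm (x i - l) <= u i) ->
  (forall eps : R, 0 < eps -> exists i0, forall i, le i0 i -> u i < eps) ->
  snet_cvg le x l.
Proof.
move=> xu u0; apply/snet_cvgP => eps /u0[i0 hi].
by exists i0 => i /hi; apply: le_lt_trans.
Qed.

Definition leN (m n : nat) : Prop := (m <= n)%N.

Lemma directed_leN : directed leN.
Proof.
split=> [n|i j k||i j]; rewrite /leN; first exact: leqnn.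
- exact: leq_trans.
- by exists 0%N.
- by exists (maxn i j); rewrite leq_maxl leq_maxr.
Qed.

(** The field is general because this serves both complex spaces and [R] itself, for real and
    imaginary parts of scalar sequences. *)
Lemma cauchy_seq_cvg (K : numFieldType) (X : completeNormedModType K) (x : nat -> X) :
  (forall eps : K, 0 < eps -> exists N, forall n, (N <= n)%N -> `|x n - x N| < eps) ->
  exists l, net_cvg leN x l.
Proof.
move=> xC; have : cvg (x @ \oo)%classic.
  apply/cauchy_cvgP/cauchy_exP => eps /xC[N hN]; exists (x N).
  by exists N => //= n /= /hN; rewrite -ball_normE/= distrC.
move=> /cvg_ex[l] xl; exists l => eps eps0.
have /cvgrPdist_lt/(_ eps eps0)[N _ hN] := xl.
by exists N => n /hN /=; rewrite distrC.
Qed.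

Lemma expr_lt_eps (q D eps : R) : 0 <= q < 1 -> 0 <= D -> 0 < eps ->
  exists N, forall n, (N <= n)%N -> D * q ^+ n < eps.
Proof.
move=> /andP[q0 q1] D0 eps0.
have : (geometric D q @ \oo --> 0)%classic by apply: cvg_geometric; rewrite ger0_norm.
move=> /cvgrPdist_lt/(_ _ eps0)[N _ hN]; exists N => n /hN /=.
by rewrite sub0r normrN ger0_norm// mulr_ge0// exprn_ge0.
Qed.

Lemma geometric_dist (V : normedZmodType R[i]) (x : nat -> V) (q D : R) :
  0 <= q < 1 -> (forall n, nrm (x n.+1 - x n) <= D * q ^+ n) ->
  forall n m, (n <= m)%N -> nrm (x m - x n) <= D * q ^+ n / (1 - q).
Proof.
move=> /andP[q0 q1] xD n m nm.
suff H k : nrm (x (n + k)%N - x n) <= D * q ^+ n * (1 - q ^+ k) / (1 - q).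
  rewrite -(subnKC nm); apply: le_trans (H _) _.
  rewrite ler_pM2r ?invr_gt0 ?subr_gt0//.
  have D0 : 0 <= D * q ^+ n by exact: le_trans (nrm_ge0 _ _) (xD n).
  by have := exprn_ge0 (m - n) q0; nra.
elim: k => [|k ih]; first by rewrite addn0 subrr nrm0 expr0 subrr mulr0 mul0r.
rewrite addnS; have := nrmD _ (x (n + k).+1 - x (n + k)%N) (x (n + k)%N - x n).
rewrite addrA subrK => /le_trans; apply; apply: le_trans (lerD (xD _) ih) _.
rewrite exprD exprS le_eqVlt; apply/orP; left; apply/eqP; field.
by rewrite subr_eq0 eq_sym lt_eqF.
Qed.

Lemma geometric_cauchy (V : normedZmodType R[i]) (x : nat -> V) (q D : R) :
  0 <= q < 1 -> (forall n, nrm (x n.+1 - x n) <= D * q ^+ n) ->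
  forall eps : R, 0 < eps -> exists N, forall n, (N <= n)%N -> nrm (x n - x N) < eps.
Proof.
move=> q01 xD eps eps0.
have q1 : 0 < 1 - q by case/andP: q01; lra.
have D0 : 0 <= D by have := le_trans (nrm_ge0 _ _) (xD 0%N); rewrite expr0 mulr1.
have [|N hN] := expr_lt_eps q (D / (1 - q)) eps q01 _ eps0.
  by rewrite divr_ge0// ltW.
exists N => n Nn; apply: le_lt_trans (geometric_dist _ _ _ _ q01 xD _ _ Nn) _.
by rewrite mulrAC; exact: hN.
Qed.

Lemma geometric_cvg (X : completeNormedModType R[i]) (x : nat -> X) (q D : R) :
  0 <= q < 1 -> (forall n, nrm (x n.+1 - x n) <= D * q ^+ n) ->
  exists l, net_cvg leN x l.
Proof.
move=> q01 xD; apply: cauchy_seq_cvg => eps eps0.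
have [z zE] : exists z, eps = z%:C by apply/complex_realP/ger0_real/ltW.
have [|N hN] := geometric_cauchy _ x q D q01 xD z; first by rewrite -ltcR -zE.
by exists N => n /hN; rewrite nrmE zE ltcR.
Qed.

Lemma geometric_cvg_complex (x : nat -> R[i]) (q D : R) :
  0 <= q < 1 -> (forall n, nrm (x n.+1 - x n) <= D * q ^+ n) ->
  exists l, snet_cvg leN x l.
Proof.
move=> q01 xD; have xC := geometric_cauchy _ x q D q01 xD.
have [|a ha] := cauchy_seq_cvg R R^o (fun n => complex.Re (x n)).
  move=> eps /xC[N hN]; exists N => n /hN; apply: le_lt_trans.
  by rewrite -raddfB; exact: nrm_Re.
have [|b hb] := cauchy_seq_cvg R R^o (fun n => complex.Im (x n)).
  move=> eps /xC[N hN]; exists N => n /hN; apply: le_lt_trans.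
  by rewrite -raddfB; exact: nrm_Im.
exists (a +i* b); apply/snet_cvgP => eps eps0.
have e2 : 0 < eps / 2 by lra.
have [i1 h1] := ha _ e2; have [i2 h2] := hb _ e2.
exists (maxn i1 i2) => i; rewrite /leN geq_max => /andP[/h1 {}h1 /h2 {}h2].
apply: le_lt_trans (nrm_ReIm _) _; rewrite !raddfB/=.
by rewrite [ltRHS]splitr ltrD.
Qed.

Lemma Neumann (X : completeNormedModType R[i]) (L : X -> X) (k : R) :
  0 <= k < 1 -> (forall x y, L (x - y) = L x - L y) ->
  (forall x, nrm (L x) <= k * nrm x) -> forall b, exists w, w + L w = b.
Proof.
move=> k01 LB Lk b; have [k0 k1] := andP k01.
(* The iterates are the partial sums of the Neumann series for [(1 + L)^-1 b]. *)
pose w n := iter n (fun z => b - L z) 0.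
have wS n : w n.+1 = b - L (w n) by [].
have [|l hl] := geometric_cvg _ w k (nrm (w 1%N - w 0%N)) k01.
  elim=> [|n ih]; first by rewrite mulr1.
  have -> : w n.+2 - w n.+1 = - L (w n.+1 - w n).
    by rewrite LB [X in X - _]wS [X in _ - X]wS [X in X - _]addrC addrKA opprB opprK addrC.
  rewrite nrmN; apply: le_trans (Lk _) _; rewrite exprS mulrCA.
  exact: ler_wpM2l.
exists l; apply/eqP; rewrite -subr_eq0; apply/eqP/nrm_le_eps_eq0 => eps eps0.
move/net_cvgP: hl => /(_ (eps / 2)) []; first by lra.
move=> N hN; have h0 := hN _ (leqnn N); have h1 := hN _ (leqnSn N).
have -> : l + L l - b = - (w N.+1 - l) - L (w N - l).
  by rewrite LB wS !opprB -!addrA [L (w N) + _]addrCA [L (w N) + _]addrC subrK [- b + _]addrC.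
have := nrmD _ (- (w N.+1 - l)) (- L (w N - l)); rewrite !nrmN.
have := Lk (w N - l); have := nrm_ge0 _ (w N - l); nra.
Qed.

End RealNorm.
Arguments nrm {R V} x.
Arguments opbound {R X} M f.
Arguments is_lin {R X} f.
Arguments is_linD {R X f}.
Arguments is_lin0 {R X f}.
Arguments is_linZ {R X f}.
Arguments is_linN {R X f}.
Arguments is_linB {R X f}.

(** * Cohen factorization *)

Section Bilinear.
Variables (K : numFieldType) (X Y Z : lmodType K) (m : X -> Y -> Z).
Hypothesis m_bilin : bilin m.

Lemma bilinDl x x' y : m (x + x') y = m x y + m x' y.
Proof. by have := m_bilin.1 1 x x' y; rewrite !scale1r. Qed.

Lemma bilinDr x y y' : m x (y + y') = m x y + m x y'.
Proof. by have := m_bilin.2 1 x y y'; rewrite !scale1r. Qed.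

Lemma bilin0l y : m 0 y = 0.
Proof. by have /(congr1 (fun z => z - m 0 y)) := bilinDl 0 0 y; rewrite addr0 addrK subrr. Qed.

Lemma bilin0r x : m x 0 = 0.
Proof. by have /(congr1 (fun z => z - m x 0)) := bilinDr x 0 0; rewrite addr0 addrK subrr. Qed.

Lemma bilinZl k x y : m (k *: x) y = k *: m x y.
Proof. by have := m_bilin.1 k x 0 y; rewrite bilin0l !addr0. Qed.

Lemma bilinZr k x y : m x (k *: y) = k *: m x y.
Proof. by have := m_bilin.2 k x y 0; rewrite bilin0r !addr0. Qed.

Lemma bilinBl x x' y : m (x - x') y = m x y - m x' y.
Proof. by rewrite -scaleN1r bilinDl bilinZl scaleN1r. Qed.

Lemma bilinBr x y y' : m x (y - y') = m x y - m x y'.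
Proof. by rewrite -scaleN1r bilinDr bilinZr scaleN1r. Qed.

End Bilinear.
Arguments bilin0l {K X Y Z m}.
Arguments bilin0r {K X Y Z m}.
Arguments bilinDl {K X Y Z m}.
Arguments bilinDr {K X Y Z m}.
Arguments bilinZl {K X Y Z m}.
Arguments bilinZr {K X Y Z m}.
Arguments bilinBl {K X Y Z m}.
Arguments bilinBr {K X Y Z m}.

Section Cohen.
Local Open Scope complex_scope.
Variables (R : realType) (A B : completeNormedModType R[i]).
Variables (mul : A -> A -> A) (ract : B -> A -> B).
Hypothesis ract_bilin : bilin ract.
Hypothesis ractA : forall b a a', ract b (mul a a') = ract (ract b a) a'.
Hypothesis nrm_ract : forall b a, nrm (ract b a) <= nrm b * nrm a.
Variables (I : Type) (le : I -> I -> Prop) (e : I -> A) (C : R).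
Hypothesis dir_le : directed le.
Hypotheses (C0 : 0 <= C) (eC : forall i, nrm (e i) <= C).
Hypothesis e_left : forall a, net_cvg le (fun i => mul (e i) a) a.
Hypothesis e_right : forall a, net_cvg le (fun i => mul a (e i)) a.

(* [e i . y -> y] in the norm of the dual of [B]. *)
Definition essential (y : B -> R[i]) : Prop :=
  forall eps : R, 0 < eps -> exists i0, forall i, le i0 i ->
    opbound eps (fun b => y b - y (ract b (e i))).

(** With [(a y) b = y (b a)], one has [y - e_i y = (y - a y) - (e_i a - a) y - e_i (y - a y)]. Once
    [a] is fixed, boundedness of the net controls the last term uniformly in [i]. *)
Lemma approx_essential y : in_dual y ->
  (forall eps : R, 0 < eps -> exists a, opbound eps (fun b => y b - y (ract b a))) ->
  essential y.
Proof.
move=> /in_dualP[yl [M M0 yM]] yA eps eps0; have C_ge0 := C0.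
(* The outer terms cost [d + d * C <= eps / 2]; the other half is left for [(e_i a - a) y]. *)
pose d := eps / (2 * (C + 2)).
have d0 : 0 < d by rewrite divr_gt0//; lra.
have dE : d * (C + 2) * 2 = eps by rewrite /d; field; rewrite gt_eqF//; lra.
have [a ya] := yA d d0.
have /net_cvgP/(_ (eps / 2 / (M + 1))) [] := e_left a.
  by rewrite divr_gt0//; lra.
move=> i0 hi; exists i0 => i /hi; rewrite ltr_pdivlMr; last by lra.
move=> {}hi b.
have -> : y b - y (ract b (e i)) = (y b - y (ract b a)) +
    (- y (ract b (mul (e i) a - a)) +
     - (y (ract b (e i)) - y (ract (ract b (e i)) a))).
  by rewrite (bilinBr ract_bilin) (is_linB yl) ractA; ring.
apply: le_trans (nrmD _ _ _ _) _; apply: le_trans (lerD (lexx _) (nrmD _ _ _ _)) _.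
rewrite !nrmN; have h1 := ya b; have h2 := ya (ract b (e i)).
have h3 := yM (ract b (mul (e i) a - a)).
have h4 := nrm_ract b (e i); have h5 := nrm_ract b (mul (e i) a - a).
have h6 : nrm b * nrm (e i) <= nrm b * C by rewrite ler_wpM2l// nrm_ge0.
have b0 := nrm_ge0 _ _ b; have g0 := nrm_ge0 _ _ (mul (e i) a - a).
have h7 : M * nrm (ract b (mul (e i) a - a)) <= nrm b * (eps / 2).
  apply: le_trans (_ : M * (nrm b * nrm (mul (e i) a - a)) <= _).
    exact: ler_wpM2l.
  rewrite mulrCA ler_wpM2l//; nra.
have h8 : d * nrm (ract b (e i)) <= d * (nrm b * C).
  by rewrite ler_wpM2l ?(ltW d0)//; apply: le_trans h6.
have h9 : 0 <= d * nrm b by rewrite mulr_ge0// ltW.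
rewrite -dE in h7 *; nra.
Qed.

(* [g] is small enough for [1 - g + g e i] to be invertible with inverse of norm at most 2. *)
Let g : R := 2^-1 / (1 + C).
Let q : R := 1 - g.

Lemma step_gt0 : 0 < g. Proof. by rewrite divr_gt0//; have := C0; lra. Qed.
(** The margin for invertibility: [q - g * C = 1 - (g + g * C) = 2^-1] bounds each factor from
    below. *)
Lemma step_sum : g + g * C = 2^-1.
Proof. by rewrite /g; field; rewrite gt_eqF//; have := C0; lra. Qed.
Lemma stepC_ge0 : 0 <= g * C. Proof. by rewrite mulr_ge0// ltW// step_gt0. Qed.
Lemma decay01 : 0 <= q < 1.
Proof. by have := step_gt0; have := step_sum; have := stepC_ge0; rewrite /q; lra. Qed.

(** Right multiplication on [B] by the element [q + g c] of the unitization, which is never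
    constructed. *)
Let relax c w := q%:C *: w + g%:C *: ract w c.

Lemma relax_linear c k w w' : relax c (k *: w + w') = k *: relax c w + relax c w'.
Proof.
rewrite /relax (bilinDl ract_bilin) (bilinZl ract_bilin) !scalerDr !scalerA addrACA.
by rewrite ![k * _]mulrC.
Qed.

Lemma relax_bound c w : nrm c <= C -> nrm w <= 2 * nrm (relax c w).
Proof.
move=> cC; have g0 := ltW step_gt0; have w0 := nrm_ge0 _ _ w.
have := nrmD _ _ (relax c w) (- (g%:C *: ract w c)).
rewrite /relax addrK nrmN !nrmZ !nrm_real//; last by case/andP: decay01.
move: (nrm (_ + _)) => u h1.
have h2 := nrm_ract w c; have h3 : nrm w * nrm c <= nrm w * C by rewrite ler_wpM2l.
have h4 : g * nrm (ract w c) <= g * (nrm w * C).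
  by rewrite ler_wpM2l//; apply: le_trans h3.
have h5 : (g + g * C) * nrm w = 2^-1 * nrm w by rewrite step_sum.
rewrite /q in h1; nra.
Qed.

(** Division by [q] leaves a Neumann problem: [g * C = 2^-1 - g <= q / 2], so the perturbation
    contracts by one half. *)
Lemma relax_surj c b : nrm c <= C -> exists w, relax c w = b.
Proof.
move=> cC; have g0 := step_gt0; have [q0 q1] := andP decay01.
have qgt0 : 2^-1 <= q by rewrite /q; have := step_sum; have := stepC_ge0; lra.
have [|||w hw] := Neumann _ _ (fun w => (g / q)%:C *: ract w c) 2^-1 _ _ _ (q^-1%:C *: b).
- lra.
- by move=> x y; rewrite (bilinBl ract_bilin) scalerBr.
- move=> w; have gq : 0 <= g / q by rewrite divr_ge0// ltW.
  rewrite nrmZ nrm_real//; have w0 := nrm_ge0 _ _ w.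
  have h3 : nrm (ract w c) <= nrm w * C.
    by apply: le_trans (nrm_ract _ _) _; rewrite ler_wpM2l.
  apply: le_trans (ler_wpM2l gq h3) _.
  rewrite mulrCA mulrC ler_wpM2r// mulrAC ler_pdivrMr; last by lra.
  have := step_sum; have := stepC_ge0; rewrite /q; lra.
- exists w; rewrite /relax.
  have /(congr1 (fun z => q%:C *: z)) := hw.
  have qn0 : q != 0 by rewrite gt_eqF//; lra.
  by rewrite scalerDr !scalerA -!rmorphM mulrCA !divff// mulr1 rmorph1 scale1r.
Qed.

(* [q ^+ n + s] is a product of [n] factors [1 - g + g e i] in the unitization of [A], and
   [y] is its inverse applied to [x]; new factors are appended on the right, so that
   the right approximate identity makes [s] converge. *)
Definition Cohen_state (x : B -> R[i]) (n : nat) (s : A) (y : B -> R[i]) : Prop :=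
  [/\ in_dual y, essential y &
      forall b, x b = (q ^+ n)%:C * y b + y (ract b s)].

(** Put [y = (q + g c) y'] with [c = e i] so late that [s c] and [c y] are within [q ^+ n] of [s]
    and [y]. The increment [y' - y] is [g (y - c y)] composed with the inverse [W] of the factor,
    hence small. *)
Lemma Cohen_step x n s y : Cohen_state x n s y ->
  exists s' y', [/\ Cohen_state x n.+1 s' y', nrm (s' - s) <= q ^+ n &
    opbound (q ^+ n) (fun b => y' b - y b)].
Proof.
move=> [/in_dualP[yl [M M0 yM]] yess xE].
have g0 := step_gt0; have [q0 q1] := andP decay01; have gC := step_sum; have gC0 := stepC_ge0.
have qgt0 : 0 < q by rewrite /q; lra.
have qn0 : 0 < q ^+ n by rewrite exprn_gt0.
have [i1 h1] := yess _ qn0.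
have /net_cvgP/(_ _ qn0)[i2 h2] := e_right s.
have [_ _ _ dir] := dir_le; have [i [/h1 {}h1 /h2 {}h2]] := dir i1 i2.
set c := e i in h1 h2; have cC : nrm c <= C by exact: eC.
(* Preimages are merely chosen; linearity of [W] is recovered from the injectivity contained in
   [relax_bound]. *)
have [W WE] := choice (fun b => relax_surj c b cC).
have WL k b b' : W (k *: b + b') = k *: W b + W b'.
  apply/eqP; rewrite -subr_eq0; apply/eqP/nrm0_eq0/eqP.
  rewrite eq_le nrm_ge0 andbT; apply: le_trans (relax_bound c _ cC) _.
  rewrite -scaleN1r addrC !relax_linear !WE scaleN1r addNr nrm0 mulr0//.
have WB b : nrm (W b) <= 2 * nrm b by rewrite -{2}[b]WE; exact: relax_bound.
have Wrelax w : W (relax c w) = w.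
  apply/eqP; rewrite -subr_eq0; apply/eqP/nrm0_eq0/eqP.
  rewrite eq_le nrm_ge0 andbT; apply: le_trans (relax_bound c _ cC) _.
  by rewrite -scaleN1r addrC relax_linear WE scaleN1r addNr nrm0 mulr0.
pose y' b := y (W b).
have y'l : is_lin y' by move=> k u v; rewrite /y' WL yl.
have y'M : opbound (2 * M) y'.
  move=> b; apply: le_trans (yM _) _; have := WB b; nra.
have qE : q%:C = 1 - g%:C by rewrite /q rmorphB rmorph1.
have yE b : y b = q%:C * y' b + g%:C * y' (ract b c).
  rewrite -(is_linZ y'l) -[X in _ + X](is_linZ y'l) -(is_linD y'l).
  by rewrite /y' -[X in W X]/(relax c b) Wrelax.
(* The expansion of [(q ^+ n + s) (q + g c)] without its scalar part [q ^+ n.+1]. *)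
exists (s + g%:C *: (mul s c - s) + (g * q ^+ n)%:C *: c), y'; split; first split.
- by apply/in_dualP; split=> //; exists (2 * M) => //; lra.
(* Up to the factor [q], the defect [y' - e_j y'] is that of [y] plus [g (e_j c - c) y'], which the
   left approximate identity makes small. *)
- move=> eps eps0.
  have [|j1 k1] := yess (eps * q / 2); first by nra.
  have /net_cvgP/(_ (eps * q / 2 / (g * (2 * M) + 1))) [] := e_left c.
    by rewrite divr_gt0//; nra.
  move=> j2 k2; have [_ tr _ _] := dir_le.
  have [j0 [l1 l2]] := dir j1 j2; exists j0 => j lj b.
  have {}k1 := k1 j (tr _ _ _ l1 lj) b; have {k2} := k2 j (tr _ _ _ l2 lj).
  rewrite ltr_pdivlMr; last by nra.
  move=> k2; rewrite -(ler_pM2l qgt0) -{1}(nrm_real _ q)// -nrmM.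
  have -> : q%:C * (y' b - y' (ract b (e j))) =
    (y b - y (ract b (e j))) + g%:C * y' (ract b (mul (e j) c - c)).
    by rewrite (bilinBr ract_bilin) (is_linB y'l) ractA !yE; ring.
  apply: le_trans (nrmD _ _ _ _) _; rewrite nrmM (nrm_real _ _ (ltW g0)).
  have k3 := y'M (ract b (mul (e j) c - c)).
  have k4 := nrm_ract b (mul (e j) c - c).
  have k5 : 2 * M * nrm (ract b (mul (e j) c - c)) <= 2 * M * (nrm b * nrm (mul (e j) c - c)).
    by rewrite ler_wpM2l//; lra.
  have k6 : g * nrm (y' (ract b (mul (e j) c - c))) <=
      g * (2 * M * (nrm b * nrm (mul (e j) c - c))).
    by apply: ler_wpM2l; [exact: ltW | exact: le_trans k5].
  have k7 : nrm b * (nrm (mul (e j) c - c) * (g * (2 * M) + 1)) <= nrm b * (eps * q / 2).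
    by rewrite ler_wpM2l ?nrm_ge0// ltW.
  have k8 : 0 <= nrm b * nrm (mul (e j) c - c) by rewrite mulr_ge0 ?nrm_ge0.
  nra.
- move=> b; rewrite xE !yE.
  rewrite !(bilinDr ract_bilin) !(bilinZr ract_bilin) (bilinBr ract_bilin).
  rewrite !(is_linD y'l) !(is_linZ y'l) (is_linB y'l) ractA.
  rewrite exprS (rmorphM _ q) (rmorphM _ g (q ^+ n)) /= qE; ring.
- rewrite -[s + _ + _]addrA [s + _]addrC addrK.
  apply: le_trans (nrmD _ _ _ _) _; rewrite !nrmZ.
  have gq0 : 0 <= g * q ^+ n by apply: mulr_ge0; exact: ltW.
  rewrite (nrm_real _ g (ltW g0)) (nrm_real _ _ gq0).
  have : (g * q ^+ n) * nrm c <= (g * q ^+ n) * C by exact: ler_wpM2l.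
  have : g * nrm (mul s c - s) <= g * q ^+ n by apply: ler_wpM2l; exact: ltW.
  have : (g + g * C) * q ^+ n = 2^-1 * q ^+ n by rewrite gC.
  nra.
- move=> b; rewrite -{1 2}[b]WE /relax.
  have -> : y' (q%:C *: W b + g%:C *: ract (W b) c) - y (q%:C *: W b + g%:C *: ract (W b) c)
     = g%:C * (y (W b) - y (ract (W b) c)).
    rewrite -/(relax c (W b)) {1}/y' Wrelax /relax (is_linD yl) !(is_linZ yl) qE; ring.
  rewrite nrmM (nrm_real _ _ (ltW g0)).
  have k1 := h1 (W b); have k2 := WB b.
  have k3 : q ^+ n * nrm (W b) <= q ^+ n * (2 * nrm b).
    by apply: ler_wpM2l => //; exact: ltW.
  have k4 : g * nrm (y (W b) - y (ract (W b) c)) <= g * (q ^+ n * (2 * nrm b)).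
    by apply: ler_wpM2l; [exact: ltW | exact: le_trans k3].
  have k5 : 0 <= q ^+ n * nrm b by rewrite mulr_ge0 ?nrm_ge0 ?ltW.
  nra.
Qed.

(** The increments are summable, so [s n -> a] in norm and [y n -> z] pointwise; as [q ^+ n -> 0],
    the invariant [x = (q ^+ n + s n) y n] becomes [x = a z]. *)
Theorem Cohen_factorization x : in_dual x -> essential x ->
  exists y a, in_dual y /\ forall b, x b = y (ract b a).
Proof.
move=> xd xess; have [q0 q1] := andP decay01.
have /choice[F FP] (t : nat * (A * (B -> R[i]))) : exists p' : A * (B -> R[i]),
    Cohen_state x t.1 t.2.1 t.2.2 ->
    [/\ Cohen_state x t.1.+1 p'.1 p'.2, nrm (p'.1 - t.2.1) <= q ^+ t.1 &
      opbound (q ^+ t.1) (fun b => p'.2 b - t.2.2 b)].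
  (* The recursion needs a total function; off the invariant any pair will do. *)
  have [st|nst] := pselect (Cohen_state x t.1 t.2.1 t.2.2); last by exists (0, x).
  by have [s' [y' h]] := Cohen_step _ _ _ _ st; exists (s', y').
pose st := fix st n : A * (B -> R[i]) := if n is n'.+1 then F (n', st n') else (0, x).
have stP n : Cohen_state x n (st n).1 (st n).2.
  elim: n => [|n /(FP (n, st n))[]//].
  split=> // b; rewrite /= (bilin0r ract_bilin) (is_lin0 xd.1).
  by rewrite expr0 rmorph1 mul1r addr0.
pose s n := (st n).1; pose y n := (st n).2.
have [|a sa] := geometric_cvg _ _ s q 1 decay01.
  by move=> n; rewrite mul1r; case: (FP (n, st n) (stP n)).
have yq b n : nrm (y n.+1 b - y n b) <= nrm b * q ^+ n.
  by rewrite mulrC; case: (FP (n, st n) (stP n)) => _ _; exact.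
have /choice[z yz] b : exists z, snet_cvg leN (fun n => y n b) z.
  exact: geometric_cvg_complex decay01 (yq b).
have /in_dualP[xl [M M0 xM]] := xd.
(* A bound for [x] plus the sum of all increments. The bound from a single step doubles each time,
   whereas this one is uniform in [n]. *)
pose M' := M + (1 - q)^-1.
have M'0 : 0 <= M' by rewrite addr_ge0// invr_ge0 subr_ge0 ltW.
have yM n : opbound M' (y n).
  move=> b; have := geometric_dist _ _ (fun n => y n b) _ _ decay01 (yq b) _ _ (leq0n n).
  rewrite expr0 mulr1 -[y 0%N b]/(x b) => h.
  have := nrmD _ _ (y n b - x b) (x b); rewrite subrK.
  have := xM b; rewrite /M' mulrDl [_^-1 * _]mulrC; lra.
have yl n : is_lin (y n) by have [[]] := stP n.
have dirN := directed_leN.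
exists z, a; split.
  apply/in_dualP; split.
    move=> k u v; apply: (snet_cvg_unique _ _ _ _ _ _ dirN (yz _)).
    have := snet_cvg_linear _ _ _ _ _ k _ _ dirN (yz u) (yz v).
    by under [X in snet_cvg _ X]eq_fun do rewrite -yl.
  exists M' => // b; apply: (snet_cvg_bound _ _ _ _ _ _ dirN (yz b)) => n.
  exact: yM.
move=> b.
have c1 : snet_cvg leN (fun n => y n (ract b (s n - a))) 0.
  apply: (snet_cvg_dist _ _ _ _ _ (fun n => M' * (nrm b * nrm (s n - a)))).
    move=> n; rewrite subr0; apply: le_trans (yM _ _) _.
    exact: ler_wpM2l.
  move=> eps eps0; have b0 := nrm_ge0 _ _ b.
  have Mb : 0 <= M' * nrm b by exact: mulr_ge0.
  have /net_cvgP/(_ (eps / (M' * nrm b + 1))) [|N hN] := sa.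
    by rewrite divr_gt0//; lra.
  exists N => n /hN; rewrite ltr_pdivlMr; last by lra.
  by have := nrm_ge0 _ _ (s n - a); nra.
have c2 : snet_cvg leN (fun n => (q ^+ n)%:C * y n b) 0.
  apply: (snet_cvg_dist _ _ _ _ _ (fun n => (M' * nrm b) * q ^+ n)).
    move=> n; rewrite subr0 nrmM nrm_real ?exprn_ge0// mulrC.
    by apply: ler_wpM2r; [exact: exprn_ge0 | exact: yM].
  by move=> eps; apply: (expr_lt_eps _ _ _ _ decay01); rewrite mulr_ge0 ?nrm_ge0.
have c3 := snet_cvg_linear _ _ _ _ _ 1 _ _ dirN c1 (yz (ract b a)).
have c4 := snet_cvg_linear _ _ _ _ _ 1 _ _ dirN c2 c3.
rewrite !mulr0 !add0r in c4; apply: (snet_cvg_unique _ _ _ _ _ _ dirN _ c4).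
(* The three sequences add up to the constant [x b], which identifies the limit. *)
move=> eps eps0; exists 0%N => n _; have [_ _ xE] := stP n.
rewrite (xE b) -/(y n) -/(s n) (bilinBr ract_bilin) (is_linB (yl n)).
by rewrite !mul1r subrK subrr normr0.
Qed.

End Cohen.

(** * Dual and bidual spaces *)

Section DualSpace.
Variables (R : realType) (X : normedModType R[i]).

(** The dual becomes a vector space type so that Hahn-Banach can be applied to it. *)
Definition dual_pred : {pred X -> R[i]^o} := fun f => `[< @in_dual R[i] X f >].

Lemma in_dual0 : @in_dual R[i] X (fun _ => 0).
Proof.
split=> [k x y|]; first by rewrite mulr0 addr0.
by exists 0 => x; rewrite normr0 mul0r.
Qed.

Lemma in_dual_linear k (f h : X -> R[i]) :
  in_dual f -> in_dual h -> in_dual (fun x => k * f x + h x).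
Proof.
move=> /in_dualP[fl [M M0 fM]] /in_dualP[hl [N N0 hN]]; apply/in_dualP; split.
  by move=> l x y; rewrite fl hl; ring.
have k0 := nrm_ge0 _ _ k.
exists (nrm k * M + N); first by rewrite addr_ge0// mulr_ge0.
move=> x; apply: le_trans (nrmD _ _ _ _) _; rewrite nrmM mulrDl -mulrA.
by apply: lerD (hN x); apply: ler_wpM2l.
Qed.

Lemma dual_pred_submod : submod_closed dual_pred.
Proof.
split; first by apply/asboolP; exact: in_dual0.
by move=> k f h /asboolP fd /asboolP hd; apply/asboolP; exact: in_dual_linear.
Qed.

HB.instance Definition _ :=
  GRing.isSubmodClosed.Build R[i] (X -> R[i]^o) dual_pred
    (GRing.submod_closed_semi dual_pred_submod).

Record dual := Dual { dual_fun : X -> R[i]^o ; _ : dual_fun \in dual_pred }.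
HB.instance Definition _ := [isSub for dual_fun].
HB.instance Definition _ := [Choice of dual by <:].
HB.instance Definition _ := [SubChoice_isSubLmodule of dual by <:].

Lemma dual_funP (d : dual) : in_dual (dual_fun d).
Proof. by apply/asboolP; case: d. Qed.

Definition to_dual (f : X -> R[i]) : dual := insubd 0 f.

Lemma to_dualK f : in_dual f -> dual_fun (to_dual f) = f.
Proof. by move=> fd; rewrite -[LHS]/(val (insubd _ _)) insubdK//; apply/asboolP. Qed.

End DualSpace.
Arguments dual_fun {R X}.
Arguments to_dual {R X}.

Lemma in_bidual_eq0 (R : realType) (X : normedModType R[i]) (F : (X -> R[i]) -> R[i]) :
  in_bidual F -> F (fun _ => 0) = 0.
Proof.
move=> [FL _]; have := FL 1 _ _ (in_dual0 R X) (in_dual0 R X).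
rewrite (_ : (fun x : X => 1 * 0 + 0) = (fun=> 0)); last first.
  by apply/funext => x; rewrite mulr0 addr0.
by move=> /eqP; rewrite mul1r -subr_eq subrr eq_sym => /eqP.
Qed.

Section Bidual.
Local Open Scope classical_set_scope.
Local Open Scope complex_scope.
Variables (R : realType) (X : normedModType R[i]).

(** Hahn-Banach for the dual-norm distance to [N], which vanishes on [N] and is at least [eps] at
    [f0]. *)
Lemma bidual_separation (N : (X -> R[i]) -> Prop) (f0 : X -> R[i]) (eps : R) :
  (forall f, N f -> in_dual f) -> N (fun _ => 0) ->
  (forall k f h, N f -> N h -> N (fun x => k * f x + h x)) ->
  in_dual f0 -> 0 < eps -> (forall f, N f -> ~ opbound eps (fun x => f0 x - f x)) ->
  exists F, [/\ in_bidual F, forall f, N f -> F f = 0 & F f0 <> 0].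
Proof.
move=> Nd N0 Nlin f0d eps0 Nf0.
pose S (d : dual R X) := [set M : R | 0 <= M /\
  exists2 f, N f & opbound M (fun x => dual_fun d x - f x)].
have Slb d : lbound (S d) 0 by move=> M [].
have sS : sublinear _ _ (fun d => inf (S d)).
  apply: sublinear_inf.
  - move=> d; have /in_dualP[_ [M M0 dM]] := dual_funP _ _ d; exists M; split=> //.
    by exists (fun=> 0) => // x; rewrite subr0.
  - by move=> d; exists 0; exact: Slb.
  - move=> d d' s t [s0 [f Nf fs]] [t0 [f' Nf' ft]]; exists (s + t) => //.
    split; first exact: addr_ge0.
    exists (fun x => 1 * f x + f' x); first exact: Nlin.
    move=> x; have -> : dual_fun (d + d') x - (1 * f x + f' x) =
      (dual_fun d x - f x) + (dual_fun d' x - f' x).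
      by rewrite -[dual_fun (d + d') x]/(dual_fun d x + dual_fun d' x); ring.
    by rewrite mulrDl; apply: le_trans (nrmD _ _ _ _) _; apply: lerD.
  - move=> r d s r0 [s0 [f Nf fs]]; exists (r * s) => //; split.
      by rewrite mulr_ge0// ltW.
    exists (fun x => r%:C * f x + 0); first exact: Nlin.
    move=> x; have -> : dual_fun (r%:C *: d) x - (r%:C * f x + 0) =
      r%:C * (dual_fun d x - f x).
      by rewrite -[dual_fun (r%:C *: d) x]/(r%:C * dual_fun d x); ring.
    by rewrite nrmM (nrm_real _ _ (ltW r0)) -mulrA; apply: ler_wpM2l => //; exact: ltW.
have [G [GL GRe GIm Gf0]] := Hahn_Banach_complex _ _ _ (to_dual f0) sS.
(* Testing the multiples of [d] by 1, -1, i and -i bounds real and imaginary parts by [M]; the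
   factor 2 is harmless, since only boundedness matters. *)
have G_le d M f : 0 <= M -> N f -> opbound M (fun x => dual_fun d x - f x) ->
    nrm (G d) <= M * 2.
  move=> M0 Nf dM.
  have infS k : nrm k = 1 -> inf (S (k *: d)) <= M.
    move=> k1; apply: ge_inf; first by exists 0; exact: Slb.
    split=> //; exists (fun x => k * f x + 0); first exact: Nlin.
    move=> x; have -> : dual_fun (k *: d) x - (k * f x + 0) = k * (dual_fun d x - f x).
      by rewrite -[dual_fun (k *: d) x]/(k * dual_fun d x); ring.
    by rewrite nrmM k1 mul1r.
  have nrm1 : nrm (1 : R[i]) = 1 by rewrite nrm_real.
  have GN : G (- d) = - G d.
    have G0 : G 0 = 0.
      by have /eqP := GL 1 0 0; rewrite scaler0 addr0 mul1r -subr_eq subrr eq_sym => /eqP.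
    by have := GL (-1) d 0; rewrite scaleN1r addr0 G0 addr0 mulN1r.
  have r1 : complex.Re (G d) <= M.
    by apply: le_trans (GRe _) _; rewrite -[d]scale1r; exact: infS.
  have r2 : - complex.Re (G d) <= M.
    rewrite -raddfN -GN; apply: le_trans (GRe _) _.
    by rewrite -scaleN1r; apply: infS; rewrite nrmN.
  have i1 : complex.Im (G d) <= M.
    apply: le_trans (GIm _) _.
    by rewrite -scaleNr; apply: infS; rewrite nrmN nrm_i.
  have i2 : - complex.Im (G d) <= M.
    rewrite -raddfN -GN; apply: le_trans (GIm _) _.
    by rewrite scalerN opprK; apply: infS; exact: nrm_i.
  apply: le_trans (nrm_ReIm _ _) _.
  have : `|complex.Re (G d)| <= M by rewrite ler_norml r1 lerNl r2.
  have : `|complex.Im (G d)| <= M by rewrite ler_norml i1 lerNl i2.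
  lra.
exists (fun f => G (to_dual f)); split.
- split.
    move=> k f h fd hd; rewrite -GL; congr G; apply: val_inj.
    rewrite -[LHS]/(dual_fun _) to_dualK; last exact: in_dual_linear.
    by apply/funext => x; rewrite -[RHS]/(k * dual_fun _ x + dual_fun _ x) !to_dualK.
  exists 2%:R => f M fd M0 fM.
  have [m mE] : exists m, M = m%:C by apply/complex_realP/ger0_real.
  subst M; rewrite nrmE -(rmorph_nat (real_complex R)) -rmorphM lecR mulrC.
  apply: (G_le _ _ (fun=> 0)) => //; first by rewrite -ler0c.
  by move=> x; rewrite subr0 to_dualK// -lecR rmorphM /= -!nrmE.
- move=> f Nf; apply: nrm0_eq0; apply/eqP; rewrite eq_le nrm_ge0 andbT.
  rewrite -(mul0r 2); apply: (G_le _ _ f) => // x.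
  by rewrite to_dualK ?subrr ?nrm0 ?mul0r//; exact: Nd.
- move=> F0; have : eps <= inf (S (to_dual f0)).
    apply: lb_le_inf.
      have /in_dualP[_ [M M0 dM]] := f0d; exists M; split=> //.
      by exists (fun=> 0) => // x; rewrite subr0 to_dualK.
    move=> M [M0 [f Nf fM]]; rewrite leNgt; apply/negP => Meps; apply: (Nf0 f Nf) => x.
    have := fM x; rewrite to_dualK// => /le_trans; apply.
    by rewrite ler_wpM2r ?nrm_ge0// ltW.
  by rewrite -Gf0 F0 /=; lra.
Qed.

(** Membership in the span is expressed through predicates stable under linear combinations, so no
    coefficients appear. *)
Lemma kernel_span (fs : seq (X -> R[i])) (f : X -> R[i]) (P : (X -> R[i]) -> Prop) :
  (forall g, g \in fs -> is_lin g) -> is_lin f ->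
  (forall x, (forall g, g \in fs -> g x = 0) -> f x = 0) ->
  P (fun _ => 0) ->
  (forall k g h, P g -> P h -> P (fun x => k * g x + h x)) ->
  (forall g, g \in fs -> P g) -> P f.
Proof.
move=> + + + P0 PD; elim: fs f => [|g gs ih] f fsl fl fker fsP.
  by rewrite (_ : f = (fun=> 0))//; apply/funext => x; exact: fker.
have gl : is_lin g by apply: fsl; rewrite mem_head.
have gsl h : h \in gs -> is_lin h by move=> hgs; apply: fsl; rewrite in_cons hgs orbT.
have gsP h : h \in gs -> P h by move=> hgs; apply: fsP; rewrite in_cons hgs orbT.
have [fv|] := pselect (forall x, (forall h, h \in gs -> h x = 0) -> f x = 0).
  exact: ih.
move=> /existsNP[x0 /not_implyP[x0gs fx0]].
have gx0 : g x0 != 0.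
  apply/eqP => gx0; apply: fx0; apply: fker => h.
  by rewrite in_cons => /orP[/eqP ->//|]; exact: x0gs.
(* With this constant [f - c g] vanishes on the common kernel of [gs], because subtracting a
   multiple of [x0] moves any point of it into the kernel of [g]. *)
pose c := f x0 / g x0.
rewrite (_ : f = (fun x => c * g x + (- c * g x + f x))); last first.
  by apply/funext => x; ring.
apply: PD; first by apply: fsP; rewrite mem_head.
apply: ih => //.
- by move=> k x y; rewrite gl fl; ring.
- move=> y ygs.
  have := fker (- (g y / g x0) *: x0 + y); rewrite fl => h.
  rewrite /c -[RHS]h; first by field.
  move=> h'; rewrite in_cons => /orP[/eqP ->|h'gs].
    by rewrite gl; field.
  by rewrite (gsl _ h'gs) (x0gs _ h'gs) (ygs _ h'gs) mulr0 addr0.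
Qed.

(* Helly's theorem without norm control. *)
Lemma bidual_interpolation (fs : seq (X -> R[i])) F :
  in_bidual F -> (forall g, g \in fs -> in_dual g) ->
  exists x, forall g, g \in fs -> F g = g x.
Proof.
move=> Fb; have [FL _] := Fb; elim: fs => [|g gs ih] fsd; first by exists 0.
have gd : in_dual g by apply: fsd; rewrite mem_head.
have gsd h : h \in gs -> in_dual h by move=> hgs; apply: fsd; rewrite in_cons hgs orbT.
have [x1 hx1] := ih gsd.
have [gv|] := pselect (forall x, (forall h, h \in gs -> h x = 0) -> g x = 0).
  exists x1 => h; rewrite in_cons => /orP[/eqP ->|]; last exact: hx1.
  suff [] : in_dual g /\ F g = g x1 by [].
  (* Here [g] is in the span of [gs], and agreement of [F] with evaluation at [x1] is a linear
     condition. *)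
  apply: (kernel_span gs g (fun h => in_dual h /\ F h = h x1)) => //.
  - by move=> h' /gsd[].
  - by case: gd.
  - split; first exact: in_dual0.
    exact: in_bidual_eq0.
  - move=> k f h' [fd Ff] [hd Fh]; split; first exact: in_dual_linear.
    by rewrite FL// Ff Fh.
  - by move=> h' h'gs; split; [exact: gsd | exact: hx1].
move=> /existsNP[x0 /not_implyP[x0gs /eqP gx0]].
(* Moving along [x0] corrects the value of [g] and leaves those of [gs] unchanged. *)
exists (((F g - g x1) / g x0) *: x0 + x1) => h.
rewrite in_cons => /orP[/eqP ->|hgs].
  by rewrite gd.1; field.
by rewrite (gsd _ hgs).1 (x0gs _ hgs) mulr0 add0r hx1.
Qed.

Lemma in_bidual_canon (x : X) : in_bidual (canon_emb x : (X -> R[i]) -> R[i]).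
Proof.
split=> //; exists `|x| => f M _ _ fM; rewrite mulrC; exact: fM.
Qed.

(** The net is indexed by finite lists of functionals under inclusion and agrees exactly with [F] on
    each list. It may be unbounded, which [wstar_continuous] allows. *)
Lemma bidual_dense F : @in_bidual R[i] X F ->
  exists (J : Type) (leJ : J -> J -> Prop) (x : J -> X),
    directed leJ /\ wstar_cvg leJ (fun j => canon_emb (x j)) F.
Proof.
move=> Fb; exists (seq (dual R X)), (fun s t => {subset s <= t}).
have /choice[x xP] (s : seq (dual R X)) :
    exists x, forall d, d \in s -> F (dual_fun d) = dual_fun d x.
  have [|x hx] := bidual_interpolation [seq (dual_fun d : X -> R[i]) | d <- s] F Fb.
    by move=> _ /mapP[d _ ->]; exact: dual_funP.
  by exists x => d ds; apply: hx; exact: map_f.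
exists x; split.
  split=> [s z//|s t u st tu z /st /tu//||s t]; first by exists nil.
  by exists (s ++ t); split=> z zs; rewrite mem_cat zs ?orbT.
move=> f fd eps eps0; exists [:: to_dual f] => s fs.
have /xP : to_dual f \in s by apply: fs; rewrite mem_head.
rewrite to_dualK// => ->.
by rewrite /canon_emb subrr normr0.
Qed.

End Bidual.

(** * Topological centers *)

Lemma bilin_transp (K : numFieldType) (X Y Z : lmodType K) (m : X -> Y -> Z) :
  bilin m -> bilin (transp m).
Proof. by move=> [ml mr]; split=> k ? ? ?; [exact: mr | exact: ml]. Qed.

Lemma in_dual_bilin (R : realType) (X Y Z : normedModType R[i]) (m : X -> Y -> Z)
    (f : Z -> R[i]) x :
  bilin m -> (forall x y, nrm (m x y) <= nrm x * nrm y) ->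
  in_dual f -> in_dual (fun y => f (m x y)).
Proof.
move=> mb mM /in_dualP[fl [M M0 fM]]; apply/in_dualP; split.
  by move=> k y y'; rewrite mb.2 fl.
exists (M * nrm x); first by rewrite mulr_ge0 ?nrm_ge0.
by move=> y; apply: le_trans (fM _) _; rewrite -mulrA ler_wpM2l.
Qed.

Section Factorization.
Variables (R : realType) (A B : completeNormedModType R[i]).
Variables (mul : A -> A -> A) (lact : A -> B -> B) (ract : B -> A -> B).
Variables (I : Type) (le : I -> I -> Prop) (e : I -> A) (e'' : (A -> R[i]) -> R[i]).
Hypotheses (lact_bilin : bilin lact) (ract_bilin : bilin ract).
Hypothesis nrm_lact : forall a b, nrm (lact a b) <= nrm a * nrm b.
Hypothesis nrm_ract : forall b a, nrm (ract b a) <= nrm b * nrm a.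
Hypothesis dir_le : directed le.
Hypothesis e_lact : forall b, net_cvg le (fun i => lact (e i) b) b.
Hypothesis e_ract : forall b, net_cvg le (fun i => ract b (e i)) b.
Hypothesis e''_bidual : in_bidual e''.
Hypothesis e_cvg : wstar_cvg le (fun i => canon_emb (e i)) e''.

Lemma limit_lact f b : in_dual f -> e'' (fun a => f (lact a b)) = f b.
Proof.
move=> fd; apply: (snet_cvg_unique _ _ _ _ _ _ dir_le _ (in_dual_cvg _ _ _ _ _ _ _ fd (e_lact b))).
apply: (e_cvg (fun a => f (lact a b))); apply: (in_dual_bilin _ _ _ _ (transp lact) f b) => //.
  exact: bilin_transp.
by move=> x a; rewrite mulrC; exact: nrm_lact.
Qed.

Lemma limit_ract f b : in_dual f -> e'' (fun a => f (ract b a)) = f b.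
Proof.
move=> fd; apply: (snet_cvg_unique _ _ _ _ _ _ dir_le _ (in_dual_cvg _ _ _ _ _ _ _ fd (e_ract b))).
by apply: (e_cvg (fun a => f (ract b a))); exact: (in_dual_bilin _ _ _ _ ract f b).
Qed.

(** In [adj3t] the limit [e''] is evaluated innermost, where [limit_lact] applies; the hypothesis
    transfers the result to [adj3]. *)
Lemma topcenter_limit :
  (forall b'', in_bidual b'' -> Zt_at lact e'' b'') -> topcenter lact e''.
Proof.
move=> Zt; split=> // J leJ u l dirJ ub lb ul f fd.
have lactE b'' : in_bidual b'' -> adj3 lact e'' b'' f = b'' f.
  move=> /Zt[_ /(_ f fd) <-]; rewrite /adj3t /adj3; congr b''.
  by apply/funext => b; exact: limit_lact.
rewrite lactE//; under [X in snet_cvg _ X]eq_fun do rewrite lactE//.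
exact: ul.
Qed.

(** On [B] this is [limit_ract]; weak* continuity carries it along a net from [B] to [b'']. *)
Lemma topcenter_t_limit b'' f : topcenter_t ract e'' -> in_bidual b'' -> in_dual f ->
  e'' (fun a => b'' (fun b => f (ract b a))) = b'' f.
Proof.
move=> [_ e''c] b''b fd; have [J [leJ [x [dirJ xb'']]]] := bidual_dense _ _ _ b''b.
have := e''c J leJ _ _ dirJ (fun j => in_bidual_canon _ _ (x j)) b''b xb'' f fd.
move=> /(snet_cvg_unique _ _ _ _ _ _ dirJ); apply.
under [X in snet_cvg _ X]eq_fun => j.
  rewrite (_ : adj3 _ _ _ _ = canon_emb (x j) f); last exact: limit_ract.
  over.
exact: xb''.
Qed.

Lemma approx_of_topcenter_t f : topcenter_t ract e'' -> in_dual f ->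
  forall eps : R, 0 < eps -> exists a, opbound eps (fun b => f b - f (ract b a)).
Proof.
move=> e''t fd eps eps0; apply: contrapT => /forallNP Nf.
pose N (h : B -> R[i]) := exists a, h = fun b => f (ract b a).
have fl : is_lin f := fd.1.
have [||||F [Fb FN Ff]] := bidual_separation _ _ N f eps _ _ _ fd eps0 _.
- move=> _ [a ->]; apply: (in_dual_bilin _ _ _ _ (transp ract) f a) => //.
    exact: bilin_transp.
  by move=> x b; rewrite mulrC; exact: nrm_ract.
- by exists 0; apply/funext => b; rewrite (bilin0r ract_bilin) (is_lin0 fl).
- move=> k _ _ [a ->] [a' ->]; exists (k *: a + a'); apply/funext => b.
  by rewrite ract_bilin.2 fl.
- by move=> _ [a ->]; exact: Nf.
apply: Ff; rewrite -(topcenter_t_limit F f e''t Fb fd) -(in_bidual_eq0 _ _ _ e''_bidual).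
by congr e''; apply/funext => a; apply: FN; exists a.
Qed.

Hypothesis ractA : forall b a a', ract b (mul a a') = ract (ract b a) a'.
Hypothesis e_bounded : bounded_net e.
Hypothesis e_left : forall a, net_cvg le (fun i => mul (e i) a) a.
Hypothesis e_right : forall a, net_cvg le (fun i => mul a (e i)) a.

(** The contrapositive, reduced to one inclusion at the single point [e''], so that it serves both
    halves. *)
Theorem Adual_full_of_topcenter :
  (forall b'', in_bidual b'' -> Zt_at lact e'' b'') ->
  (topcenter lact e'' -> topcenter_t ract e'') -> Adual_full ract.
Proof.
move=> Zt ZZ f fd; have e''t := ZZ (topcenter_limit Zt).
have [C eC] := e_bounded.
have eC' i : nrm (e i) <= nrm C.
  rewrite -[nrm C]mulr1; apply: le_complex_bound; rewrite ?nrm_ge0//.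
  by rewrite rmorph1 mulr1 -nrmE.
have C0 := nrm_ge0 _ _ C.
have fess : essential _ _ _ ract _ le e f.
  apply: (approx_essential _ _ _ mul _ _ _ _ _ _ _ _ C0 eC') => //.
  exact: approx_of_topcenter_t.
have [y [a [yd ya]]] := Cohen_factorization _ _ _ _ _ ract_bilin ractA nrm_ract _ _ _ _
  dir_le C0 eC' e_left e_right f fd fess.
by exists y, a.
Qed.

End Factorization.

Theorem mainTheorem2 (R : realType)
  (A : completeNormedModType R[i]) (mulA : A -> A -> A)
  (B : completeNormedModType R[i]) (lact : A -> B -> B) (ract : B -> A -> B)
  (I : Type) (le : I -> I -> Prop) (e : I -> A) (e'' : (A -> R[i]) -> R[i]) :
  banach_algebra mulA ->
  banach_bimodule mulA lact ract ->
  directed le ->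
  bounded_net e ->
  (forall a, net_cvg le (fun i => mulA (e i) a) a) ->
  (forall a, net_cvg le (fun i => mulA a (e i)) a) ->
  (forall b, net_cvg le (fun i => lact (e i) b) b) ->
  (forall b, net_cvg le (fun i => ract b (e i)) b) ->
  in_bidual e'' ->
  wstar_cvg le (fun i => canon_emb (e i)) e'' ->
  ((forall b'', in_bidual b'' -> Zt_at lact e'' b'') ->
     dualA_full lact -> ~ Adual_full ract ->
     ~ (forall a'', topcenter lact a'' <-> topcenter_t ract a''))
  /\
  ((forall b'', in_bidual b'' -> Z_at ract e'' b'') ->
     Adual_full ract -> ~ dualA_full lact ->
     ~ (forall a'', topcenter lact a'' <-> topcenter_t ract a'')).
Proof.
move=> _ [[lbil rbil lA rA _] [lM rM]] dir eb el er ela era e''b ecvg.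
have nM (u : A) (v : B) (w : B) : `|w| <= `|u| * `|v| -> nrm w <= nrm u * nrm v.
  by rewrite !nrmE -rmorphM lecR.
have nl a b : nrm (lact a b) <= nrm a * nrm b by exact: nM.
have nr b a : nrm (ract b a) <= nrm b * nrm a.
  by rewrite mulrC; apply: nM; rewrite mulrC.
split=> [Zt _ nfull cE|Z _ nfull cE]; apply: nfull.
  apply: (Adual_full_of_topcenter _ _ _ mulA lact _ _ le e e'') => //.
  by move=> /cE.
(* The opposite algebra exchanges the two actions and the two centers. *)
apply: (Adual_full_of_topcenter _ _ _ (transp mulA) (transp ract) (transp lact)
  _ le e e'') => //; try exact: bilin_transp.
- by move=> a b; rewrite mulrC; exact: nr.
- by move=> b a; rewrite mulrC; exact: nl.
- by move=> b a a'; rewrite /transp lA.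
(* Transposing the action swaps [adj3] and [adj3t], so the same equation is read from right to
   left. *)
- by move=> b'' /Z[b''b hZ]; split=> // f /hZ.
- by move=> /cE.
Qed.
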